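(* Let $X$ be a finite set and let $[U,V]$ be a regular interval in $\operatorname{Bip}(X)$. Then the Möbius function of $\operatorname{Bip}(X)$ satisfies $$\mu(U,V)=(-1)^{\operatorname{rk}(V)-\operatorname{rk}(U)}.$$
   Context: A relation $U\subseteq X\times X$ on a finite set $X$ is bipartitional if both $U$ and $(X\times X)\setminus U$ are transitive. $\operatorname{Bip}(X)$ is the set of bipartitional relations on $X$, partially ordered by inclusion. It is a graded poset, and $\operatorname{rk}$ denotes its rank function. For a bipartitional relation $U$, write $x\sim_U y$ if either both or none of $(x,y)$ and $(y,x)$ belong to $U$; this is an equivalence relation on $X$. An interval $[U,V]\subseteq\operatorname{Bip}(X)$ is called regular if every $x\in X$ satisfying $(x,x)\in V\setminus U$ also satisfies $\{y\in X: x\sim_U y\}=\{y\in X: x\sim_V y\}$. *)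

(* Defs.v *)
From HB Require Import structures.
From mathcomp Require Import all_boot all_order all_algebra.

Set Implicit Arguments.
Unset Strict Implicit.
Unset Printing Implicit Defensive.

Import Order.TTheory GRing.Theory.
Local Open Scope order_scope.

Section FinitePosets.
Variables (d : Order.disp_t) (T : finPOrderType d).
Implicit Types (x y z : T) (C : {set T}).

(* [n] is recursion fuel; [#|T|] is always enough, see [mobiusS]. *)
Fixpoint mobius_fuel (n : nat) x y : int :=
  if x == y then 1%R
  else if n is m.+1 then
    if x < y then (- \sum_(z : T | (x <= z < y)%O) mobius_fuel m x z)%R else 0%R
  else 0%R.

Definition mobius x y : int := mobius_fuel #|T| x y.

Definition is_chain C : bool :=
  [forall y in C, forall z in C, y >=< z].

(* Maximal length of a chain ending at [x]: if [C] lies strictly below [x],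
   then [x |: C] is a chain with [#|C|] steps.  In a graded poset this is the
   rank function, see [rk_unique]. *)
Definition rk x : nat :=
  (\max_(C : {set T} | is_chain C && [forall y in C, (y < x)%O]) #|C|)%N.

Definition covers x y : bool := (x < y) && [forall z, ~~ (x < z < y)].

Definition is_rank_function (rho : T -> nat) : Prop :=
  (forall x, [forall y, ~~ (y < x)] -> rho x = 0%N) /\
  (forall x y, covers x y -> rho y = (rho x).+1).

Lemma mobius_fuel_eq x y n m :
    (#|[set z : T | (x <= z < y)%O]| <= n)%N -> (#|[set z : T | (x <= z < y)%O]| <= m)%N ->
  mobius_fuel n x y = mobius_fuel m x y.
Proof.
elim: n m y => [|n IHn] [|m] y //=; case: eqVneq => // neq_xy;
  case: ifP => // lt_xy; rewrite ?leqn0 ?cards_eq0.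
- by move=> /eqP/setP/(_ x); rewrite !inE lexx lt_xy.
- by move=> _ /eqP/setP/(_ x); rewrite !inE lexx lt_xy.
move=> len lem; congr (- _)%R; apply: eq_bigr => z /andP[le_xz lt_zy].
have ltc : (#|[set t : T | (x <= t < z)%O]| < #|[set t : T | (x <= t < y)%O]|)%N.
  apply/proper_card/properP; split.
    by apply/subsetP => t; rewrite !inE => /andP[-> /lt_trans->].
  by exists z; rewrite !inE ?ltxx ?andbF // le_xz.
by apply: IHn; rewrite -ltnS; apply: leq_trans ltc _.
Qed.

Lemma mobiusxx x : mobius x x = 1%R.
Proof. by rewrite /mobius; case: #|T| => [|n] /=; rewrite eqxx. Qed.

Lemma mobiusS x y : x < y -> (\sum_(z : T | (x <= z <= y)%O) mobius x z = 0)%R.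
Proof.
move=> lt_xy; rewrite (bigD1 y) /=; last by rewrite (ltW lt_xy) lexx.
have -> : mobius x y = (- \sum_(z : T | (x <= z < y)%O) mobius x z)%R.
  have ltT : (#|[set t : T | (x <= t < y)%O]| < #|T|)%N.
    rewrite -cardsT; apply/proper_card/properP; split; first exact: subsetT.
    by exists y; rewrite !inE // ltxx andbF.
  rewrite /mobius -(@mobius_fuel_eq x y #|T|.+1); last 2 first.
  - by apply: ltnW; apply: ltnW.
  - exact: ltnW.
  rewrite /= (lt_eqF lt_xy) lt_xy; congr (- _)%R.
apply/eqP; rewrite addrC subr_eq0; apply/eqP/eq_bigl => z.
by rewrite lt_neqAle andbAC andbA.
Qed.

Lemma mobius_nle x y : ~~ (x <= y) -> mobius x y = 0%R.
Proof.
move=> nle; have ne : x == y = false by apply: contraNF nle => /eqP->.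
rewrite /mobius; case: #|T| => [|n] /=; rewrite ne //.
by case: ifP => // /ltW le_xy; rewrite le_xy in nle.
Qed.

Lemma rk_lt x y : x < y -> (rk x < rk y)%N.
Proof.
move=> lt_xy; rewrite {1}/rk.
have P0 : is_chain set0 && [forall y0 in set0, y0 < x].
  apply/andP; split; first by apply/forall_inP => z; rewrite inE.
  by apply/forall_inP => z; rewrite inE.
rewrite (bigop.bigmax_eq_arg set0) //; case: arg_maxnP => // C /andP[chC /forall_inP ltC] _.
have xNC : x \notin C by apply/negP => /ltC; rewrite ltxx.
have -> : #|C|.+1 = #|x |: C| by rewrite cardsU1 xNC.
rewrite /rk (bigD1 (x |: C)) ?leq_maxl //; apply/andP; split.
  apply/forall_inP => y1 /setU1P[->|y1C]; apply/forall_inP => z /setU1P[->|zC].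
  - exact: comparablexx.
  - by apply: gt_comparable; apply: ltC.
  - by apply: lt_comparable; apply: ltC.
  - by move/forall_inP: chC => /(_ _ y1C)/forall_inP; apply.
by apply/forall_inP => z /setU1P[->//|/ltC/lt_trans->].
Qed.

(* In particular [rk y - rk x] is not truncated when [x <= y]. *)
Lemma rk_le x y : x <= y -> (rk x <= rk y)%N.
Proof. by rewrite le_eqVlt => /predU1P[->//|/rk_lt/ltnW]. Qed.

Lemma below_cover x y : x < y -> exists2 z, (x <= z)%O & covers z y.
Proof.
move=> lt_xy.
have P0 : (x <= x < y)%O by rewrite lexx.
case: (@arg_maxnP _ x (fun z => (x <= z < y)%O) rk P0) => z /andP[le_xz lt_zy] maxz.
exists z => //; rewrite /covers lt_zy; apply/forallP => t.
apply/negP => /andP[lt_zt lt_ty].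
have := maxz t; rewrite (le_trans le_xz (ltW lt_zt)) lt_ty => /(_ isT).
by rewrite /= leqNgt rk_lt.
Qed.

Lemma rk_unique (rho : T -> nat) : is_rank_function rho -> rho =1 rk.
Proof.
case=> rho0 rhoS.
have rho_lt n x y : (rk y <= n)%N -> x < y -> (rho x < rho y)%N.
  elim: n y => [|n IHn] y len lt_xy; have [z le_xz cov] := below_cover lt_xy.
    by have := leq_trans (rk_lt lt_xy) len.
  rewrite (rhoS _ _ cov) ltnS; move: le_xz; rewrite le_eqVlt => /predU1P[->//|lt_xz].
  apply/ltnW/IHn => //; rewrite -ltnS; apply: leq_trans len; apply: rk_lt.
  by case/andP: cov.
have {}rho_lt x y : x < y -> (rho x < rho y)%N by apply: (rho_lt (rk y)).
move=> x; apply/eqP; rewrite eqn_leq; apply/andP; split.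
  have [n] := ubnP (rho x); elim: n x => // n IHn x ltn.
  have [/rho0->//|] := boolP [forall y, ~~ (y < x)].
  rewrite negb_forall => /existsP[y]; rewrite negbK => /below_cover[z _ cov].
  have lt_zx : z < x by case/andP: cov.
  rewrite (rhoS _ _ cov); apply: leq_ltn_trans (rk_lt lt_zx).
  by apply: IHn; move: ltn; rewrite (rhoS _ _ cov) ltnS.
apply/bigmax_leqP => C /andP[/forall_inP chC /forall_inP ltC].
pose f (y : T) : 'I_(rho x).+1 := inord (rho y).
have fE y : y \in C -> f y = rho y :> nat.
  by move=> /ltC/rho_lt lt_yx; rewrite inordK // ltnS ltnW.
have inj : {in C &, injective f}.
  move=> y z yC zC /(congr1 (@nat_of_ord _)); rewrite !fE // => eq_rho.
  move/forall_inP: (chC y yC) => /(_ z zC); case/comparable_ltgtP => //;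
    by move/rho_lt; rewrite eq_rho ltnn.
rewrite -(card_in_imset inj).
apply: leq_trans (_ : #|[set~ (ord_max : 'I_(rho x).+1)]| <= _)%N.
  apply/subset_leq_card/subsetP => _ /imsetP[y yC ->]; rewrite !inE.
  by rewrite -val_eqE /= fE // ltn_eqF //; apply/rho_lt/ltC.
by rewrite cardsC1 card_ord.
Qed.

End FinitePosets.

Section Bipartitional.
Variable X : finType.
Implicit Types U V : {set X * X}.

Definition transitive_set U : bool :=
  [forall x, forall y, forall z,
     ((x, y) \in U) && ((y, z) \in U) ==> ((x, z) \in U)].

Lemma transitive_setP U :
  reflect (transitive [rel x y | (x, y) \in U]) (transitive_set U).
Proof.
apply: (iffP forallP) => [tU y x z /= Uxy Uyz | tU x].
  by move: (tU x) => /forallP/(_ y)/forallP/(_ z)/implyP; rewrite Uxy Uyz; apply.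
by apply/forallP => y; apply/forallP => z; apply/implyP => /andP[]; apply: tU.
Qed.

Definition bipartitional U : bool := transitive_set U && transitive_set (~: U).

Definition sim U : rel X := fun x y => ((x, y) \in U) == ((y, x) \in U).

Record Bip := MkBip { bip_rel :> {set X * X}; _ : bipartitional bip_rel }.

End Bipartitional.

HB.instance Definition _ (X : finType) := [isSub for @bip_rel X].
HB.instance Definition _ (X : finType) := [Finite of Bip X by <:].

Section BipOrder.
Variable X : finType.

Let le_Bip : rel (Bip X) := fun U V => bip_rel U \subset bip_rel V.

Fact le_Bip_refl : reflexive le_Bip.
Proof. by move=> U; apply: subxx. Qed.

Fact le_Bip_anti : antisymmetric le_Bip.
Proof. by move=> U V UV; apply/val_inj/eqP; rewrite eqEsubset. Qed.

Fact le_Bip_trans : transitive le_Bip.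
Proof. by move=> V U W; apply: subset_trans. Qed.

HB.instance Definition _ := Order.Le_isPOrder.Build
  (Order.Disp tt tt) (Bip X) le_Bip_refl le_Bip_anti le_Bip_trans.

End BipOrder.

Lemma leBipE (X : finType) (U V : Bip X) :
  (U <= V) = (bip_rel U \subset bip_rel V).
Proof. by []. Qed.

Definition regular_interval (X : finType) (U V : Bip X) : Prop :=
  forall x : X, (x, x) \in bip_rel V :\: bip_rel U ->
    [set y : X | sim U x y] = [set y : X | sim V x y].

(* Main.v *)
Require Import Defs.
From mathcomp Require Import all_boot all_order all_algebra.
From mathcomp Require Import zify.
Import Order.TTheory GRing.Theory.

(** A bipartitional relation is an ordered partition of [X] into blocks (the
    classes of [sim]), each reflexive or irreflexive.  A regular [Z] above [U]
    is obtained by merging consecutive reflexive blocks of [U] and by either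
    refining an irreflexive block into an ordered partition or making it
    reflexive as a whole.  For every [V] above [U] the signs
    [(-1) ^ rank Z] of the regular [Z] in [[U, V]] cancel under a
    sign-reversing involution, so the function equal to
    [(-1) ^ (rank Z - rank U)] if [[U, Z]] is regular and to [0] otherwise
    satisfies the recursion of the Moebius function.

    The involution splits or merges blocks next to a chosen place.  If no
    irreflexive block of [U] meets [V], it toggles the separation of two
    consecutive reflexive blocks of [U] that are merged in [V].  Otherwise it
    acts inside an irreflexive block [B] of [U]: it toggles whether the first
    part of [V] in [B] is split off, or, when that part is reflexive, it
    toggles a single element as in the classical proof that the signed number
    of ordered partitions of [B] is [(-1) ^ #|B|]; the one ordered partition
    left over is paired with the reflexive block [B]. *)

Set Implicit Arguments.
Unset Strict Implicit.
Unset Printing Implicit Defensive.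

(** * Encoding by heights *)

Section Toggle.
Variable X : finType.
Implicit Types (Z W : {set X * X}) (x y z p q : X) (h : X -> nat) (L D B : {set X}).

(** The level sets of [h] are the blocks, later blocks being higher. Gaps between heights are
    allowed, so levels can be inserted or removed. *)
Definition encodes h Z :=
  (forall x y, h x = h y -> ((x, x) \in Z) = ((y, y) \in Z)) /\
  (forall x y, ((x, y) \in Z) =
     (h x < h y)%N || ((h x == h y) && ((x, x) \in Z))).

Lemma encodes_bipartitional h Z : encodes h Z -> bipartitional Z.
Proof.
case=> dh eh; apply/andP; split; apply/transitive_setP => y x z /=;
  rewrite ?inE (eh x y) (eh y z) (eh x z); have := dh x y; lia.
Qed.

Definition depth Z x := #|[set z | ((z, x) \in Z) && ((x, z) \notin Z)]|.

(** Transitivity of the complement lets every pair of [Z] be cut at any third element ([c]). Hence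
    equivalent elements have the same strict predecessors, and counting these orders the classes. *)
Lemma bipartitional_encodes Z : bipartitional Z -> encodes (depth Z) Z.
Proof.
case/andP=> /transitive_setP tZ /transitive_setP tC.
have t x y z : (x, y) \in Z -> (y, z) \in Z -> (x, z) \in Z by apply: tZ.
have c x y z : (x, z) \in Z -> (x, y) \in Z \/ (y, z) \in Z.
  move=> xz; case: (boolP ((x, y) \in Z)) => [|xy]; first by left.
  case: (boolP ((y, z) \in Z)) => [|yz]; first by right.
  by have := tC y x z; rewrite /= !inE xz xy yz => /(_ isT isT).
have lt x y : (x, y) \in Z -> (y, x) \notin Z -> (depth Z x < depth Z y)%N.
  move=> xy yx; apply/proper_card/properP; split.
    apply/subsetP => z; rewrite !inE => /andP[zx xz].
    rewrite (t _ _ _ zx xy); apply/negP => /(c _ x)[]; exact/negP.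
  by exists x; rewrite !inE ?xy ?yx // andbN.
have sub x y : ((x, y) \in Z) = ((y, x) \in Z) ->
    [set z | ((z, x) \in Z) && ((x, z) \notin Z)] \subset
    [set z | ((z, y) \in Z) && ((y, z) \notin Z)].
  move=> E; apply/subsetP => z; rewrite !inE => /andP[zx xz]; apply/andP; split.
    case/(c _ y): (zx) => // yx; move: E; rewrite yx => xy; exact: t zx xy.
  apply/negP => yz; case/(c _ x): (yz) => [yx|]; last exact/negP.
  by rewrite yx in E; move: xz; rewrite (t _ _ _ E yz).
have eq x y : ((x, y) \in Z) = ((y, x) \in Z) -> depth Z x = depth Z y.
  by move=> E; apply/eqP; rewrite eqn_leq !subset_leq_card ?sub.
have dia x y : ((x, y) \in Z) = ((y, x) \in Z) -> ((x, y) \in Z) = ((x, x) \in Z).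
  move=> E; apply/idP/idP => [xy|/(c _ y)[]//]; last by rewrite E.
  by apply: (t _ y) => //; rewrite -E.
have str x y : depth Z x = depth Z y -> ((x, y) \in Z) = ((y, x) \in Z).
  move=> E; apply/idP/idP => H; apply/negPn/negP => /(lt _ _ H);
  by rewrite E ltnn.
split=> x y.
  by move=> /str E; rewrite -(dia x y) // -(dia y x).
case: (boolP ((x, y) \in Z)) (lt x y) (lt y x) (dia x y) (eq x y);
  case: (boolP ((y, x) \in Z)) => A B l1 l2 d1 e1.
- by rewrite e1 // eqxx -(d1 erefl) orbT.
- by rewrite l1.
- by move: (l2 isT isT) => {l1 l2 d1 e1}; lia.
- by rewrite e1 // ltnn eqxx -(d1 erefl).
Qed.

Lemma encodes_sim h Z x y : encodes h Z -> sim Z x y = (h x == h y).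
Proof.
by case=> dh eh; rewrite /sim (eh x y) (eh y x); have := dh x y; lia.
Qed.

Lemma encodes_lt h Z x y : encodes h Z ->
  ((x, y) \in Z) && ((y, x) \notin Z) = (h x < h y)%N.
Proof.
by case=> dh eh; rewrite (eh x y) (eh y x); have := dh x y; lia.
Qed.

Lemma encodes_ler h Z x y : encodes h Z -> (y, y) \in Z ->
  ((x, y) \in Z) = (h x <= h y)%N.
Proof.
case=> dh eh yy; rewrite (eh x y).
by case: ltngtP => //= E; rewrite (dh x y).
Qed.

Lemma encodes_lel h Z x y : encodes h Z -> (x, x) \in Z ->
  ((x, y) \in Z) = (h x <= h y)%N.
Proof. by case=> dh eh xx; rewrite (eh x y) xx; case: ltngtP. Qed.

Definition cls Z x := [set y | sim Z x y].
Definition diag Z := [set x | (x, x) \in Z].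

(** Only the class of [p] is cut, and [p] and [r] witness that both parts are nonempty. [D] is a
    union of classes, so that the count applies to [diag Z] and to its complement. *)
Lemma card_cls_split Z Z1 h L p r D :
    (forall x y, sim Z x y = (h x == h y)) ->
    (forall x y, sim Z1 x y =
       (h x == h y) && ((h x == h p) ==> ((x \in L) == (y \in L)))) ->
    p \in L -> r \notin L -> h r = h p ->
    (forall x y, h x = h y -> (x \in D) = (y \in D)) ->
  #|cls Z1 @: D| = (#|cls Z @: D| + (p \in D))%N.
Proof.
move=> sZ sZ1 pL rL hr cD.
have same x : h x != h p -> cls Z1 x = cls Z x.
  by move=> hx; apply/setP => y; rewrite !inE sZ sZ1 (negbTE hx) andbT.
case: (boolP (p \in D)) => pD; last first.
  rewrite addn0; congr #|pred_of_set _|; apply: eq_in_imset => x xD; apply: same.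
  by apply: contraNneq pD => /cD <-.
pose D' := [set x in D | h x != h p].
have rD : r \in D by rewrite (cD r p).
have DE : D = D' :|: [set x | h x == h p].
  by apply/setP => x; rewrite !inE; case: eqP => [/cD->|]; rewrite ?pD // ?orbT ?andbT ?orbF.
have E0 : cls Z @: D = cls Z p |: (cls Z @: D').
  rewrite DE imsetU setUC; congr (_ :|: _); apply/setP => A; rewrite inE.
  apply/imsetP/eqP => [[x]|->]; last by exists p; rewrite ?inE.
  rewrite inE => /eqP hx ->; apply/setP => y; by rewrite !inE !sZ hx.
have E1 : cls Z1 @: D = cls Z1 p |: (cls Z1 r |: (cls Z @: D')).
  rewrite {1}DE imsetU setUC setUA; congr (_ :|: _); last first.
    by apply: eq_in_imset => x; rewrite inE => /andP[_ /same].
  apply/setP => A; rewrite !inE.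
  apply/imsetP/orP => [[x]|[]/eqP->]; last 2 first.
  - by exists p; rewrite ?inE.
  - by exists r; rewrite ?inE ?hr.
  rewrite inE => /eqP hx ->; case: (boolP (x \in L)) => xL; [left|right];
    apply/eqP/setP => y; rewrite !inE !sZ1 ?hr hx eqxx ?pL ?xL ?(negbTE xL) ?(negbTE rL) //=.
have notin Z2 x : (forall y, y \in cls Z2 x -> h x = h y) -> h x = h p ->
    x \in cls Z2 x -> cls Z2 x \notin cls Z @: D'.
  move=> s hx xx; apply/negP => /imsetP[z]; rewrite inE => /andP[_ hz] /setP/(_ x).
  by rewrite xx inE sZ hx (negbTE hz).
have notZ : cls Z p \notin cls Z @: D'.
  by apply: notin; rewrite ?inE ?sZ // => y; rewrite inE sZ => /eqP.
have notZ1 x : h x = h p -> cls Z1 x \notin cls Z @: D'.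
  move=> hx; apply: notin; rewrite ?inE ?sZ1 ?eqxx ?implybT // => y.
  by rewrite inE sZ1 => /andP[/eqP].
have neq : cls Z1 p != cls Z1 r.
  apply/eqP => /setP/(_ p).
  by rewrite !inE !sZ1 hr !eqxx /= pL (negbTE rL).
by rewrite E0 E1 !cardsU1 !inE negb_or neq notZ !notZ1 //= addn1 !add1n.
Qed.

(* The weights are forced by the covering relations: splitting an irreflexive
   block, merging two reflexive ones and making a singleton block reflexive
   must all add one.  The subtractions only truncate when [X] is empty. *)
Definition rho Z :=
  (#|cls Z @: ~: diag Z| + 3 * #|diag Z| - #|cls Z @: diag Z| - 1)%N.

Lemma rho_split Z Z1 h L p r :
    (forall x y, sim Z x y = (h x == h y)) ->
    (forall x y, sim Z1 x y =
       (h x == h y) && ((h x == h p) ==> ((x \in L) == (y \in L)))) ->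
    p \in L -> r \notin L -> h r = h p ->
    (forall x y, h x = h y -> ((x, x) \in Z) = ((y, y) \in Z)) ->
    diag Z1 = diag Z ->
  if (p, p) \in Z then rho Z = (rho Z1).+1 else rho Z1 = (rho Z).+1.
Proof.
move=> sZ sZ1 pL rL hr dh dE; rewrite /rho dE.
have dD x y : h x = h y -> (x \in diag Z) = (y \in diag Z) by move/dh; rewrite !inE.
have := card_cls_split sZ sZ1 pL rL hr dD; rewrite inE => u1.
have {}dD x y : h x = h y -> (x \in ~: diag Z) = (y \in ~: diag Z).
  by move/dD; rewrite !in_setC => ->.
have := card_cls_split sZ sZ1 pL rL hr dD; rewrite !inE => n1.
(* These bounds and the existence of a block keep both subtractions in [rho] from truncating. *)
have le1 : (#|cls Z @: diag Z| <= #|diag Z|)%N by apply: leq_imset_card.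
have le2 : (#|cls Z1 @: diag Z| <= #|diag Z|)%N by apply: leq_imset_card.
have pi : (p \in diag Z) || (p \in ~: diag Z) by rewrite !inE orbN.
have : (0 < #|cls Z @: diag Z|)%N || (0 < #|cls Z @: ~: diag Z|)%N.
  by case/orP: pi => /(imset_f (cls Z)) H; apply/orP; [left|right];
     rewrite card_gt0; apply/set0Pn; eexists; exact: H.
case: ((p, p) \in Z) u1 n1 => /= u1 n1; move: u1 n1 le1 le2; do 5!move: #|_|; lia.
Qed.

(** * Splitting and merging blocks *)

(** Expressed through [Z] alone, so that [toggle] depends on no choice of heights; empty when the
    block of [p] is the last. *)
Definition next_cls Z p := [set q |
  [&& (p, q) \in Z, (q, p) \notin Z &
    [forall w, ~~ [&& (p, w) \in Z, (w, p) \notin Z, (w, q) \in Z & (q, w) \notin Z]]]].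

(* Either the block of [p] is cut along [L], the part inside [L] coming first,
   or it is glued to the next block; the value [(p, p) \in Z] makes the same
   formula work for reflexive and for irreflexive blocks. *)
Definition toggle p L Z :=
  if cls Z p \subset L
  then [set xy | if (xy.1 \in cls Z p) && (xy.2 \in next_cls Z p) ||
                    (xy.1 \in next_cls Z p) && (xy.2 \in cls Z p)
                 then (p, p) \in Z else xy \in Z]
  else [set xy | if [&& xy.1 \in cls Z p, xy.2 \in cls Z p &
                       (xy.1 \in L) != (xy.2 \in L)]
                 then xy.1 \in L else xy \in Z].

Lemma in_next_cls h Z p q : encodes h Z ->
  reflect ((h p < h q)%N /\ forall w, ~~ (h p < h w < h q)%N) (q \in next_cls Z p).
Proof.
move=> e; rewrite inE andbA (encodes_lt _ _ e).
apply: (iffP andP) => -[-> H]; split=> //.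
  by move=> w; move/forallP/(_ w): H; rewrite andbA !(encodes_lt _ _ e).
by apply/forallP => w; move: (H w); rewrite andbA !(encodes_lt _ _ e).
Qed.

Lemma next_cls_eq h Z p q z : encodes h Z -> q \in next_cls Z p ->
  (z \in next_cls Z p) = (h z == h q).
Proof.
move=> e /(in_next_cls _ _ e)[lt H]; apply/(in_next_cls _ _ e)/eqP => [[lt' H']|->] //.
by have := H z; have := H' q; lia.
Qed.

Lemma in_toggle_split h Z p L r x y : encodes h Z -> h r = h p -> r \notin L ->
  ((x, y) \in toggle p L Z) =
  if [&& h x == h p, h y == h p & (x \in L) != (y \in L)] then x \in L
  else (x, y) \in Z.
Proof.
move=> e hr rL; rewrite /toggle ifN; last first.
  apply: contra rL => /subsetP; apply; by rewrite inE (encodes_sim _ _ e) hr.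
by rewrite !inE !(encodes_sim _ _ e) /= ![h p == _]eq_sym.
Qed.

Lemma in_toggle_merge h Z p L q x y : encodes h Z ->
  (forall r, h r = h p -> r \in L) -> q \in next_cls Z p ->
  ((x, y) \in toggle p L Z) =
  if (h x == h p) && (h y == h q) || (h x == h q) && (h y == h p)
  then (p, p) \in Z else (x, y) \in Z.
Proof.
move=> e KL qN; rewrite /toggle ifT; last first.
  by apply/subsetP => r; rewrite inE (encodes_sim _ _ e) eq_sym => /eqP/KL.
rewrite inE /= !(next_cls_eq _ e qN) !inE !(encodes_sim _ _ e) /=.
by rewrite ![h p == _]eq_sym.
Qed.

(** Doubling frees the level [2 * h p + 1], which receives the part of the block outside [L]. *)
Lemma encodes_toggle_split h Z p L r :
    encodes h Z -> h r = h p -> r \notin L ->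
  encodes (fun x => 2 * h x + ((h x == h p) && (x \notin L)))%N (toggle p L Z).
Proof.
move=> e hr rL; case: (e) => dh eh.
have E x y := @in_toggle_split h Z p L r x y e hr rL.
split=> x y.
  rewrite !E !eqxx !andbF => H; apply: dh; move: H.
  by case: eqP; case: eqP; case: (x \in L); case: (y \in L) => /=; lia.
rewrite !E !eqxx !andbF (eh x y).
by case: eqP; case: eqP; case: (x \in L); case: (y \in L) => /=; lia.
Qed.

(** The block of [q] drops to the height of [p]; nothing lies strictly between, so comparisons with
    other blocks survive. *)
Lemma encodes_toggle_merge h Z p L q :
    encodes h Z -> (forall r, h r = h p -> r \in L) -> q \in next_cls Z p ->
    ((p, p) \in Z) = ((q, q) \in Z) ->
  encodes (fun x => if h x == h q then h p else h x) (toggle p L Z).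
Proof.
move=> e KL qN pq; case: (e) => dh eh; have [lt adj] := in_next_cls _ _ e qN.
have E x y := @in_toggle_merge h Z p L q x y e KL qN.
split=> x y.
  rewrite !E; have := dh x y; have := dh x p; have := dh x q.
  have := dh y q; have := dh y p.
  by case: (h x =P h p); case: (h x =P h q); case: (h y =P h p); case: (h y =P h q) => /=; lia.
rewrite !E (eh x y); have := dh x p; have := dh x q; have := adj x.
have := adj y; have := dh y p; have := dh y q.
by case: (h x =P h p); case: (h x =P h q); case: (h y =P h p); case: (h y =P h q) => /=; lia.
Qed.

(* [lia] does not interpret boolean conditionals. *)
Lemma ifbE (a b c : bool) : (if a then b else c) = a && b || ~~ a && c.
Proof. by case: a; case: b. Qed.

Definition splittable h L p := exists2 r, h r = h p & r \notin L.

(** Since the next block avoids [L], cutting the merged block along [L] restores both blocks. *)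
Definition mergeable h L Z p :=
  (forall r, h r = h p -> r \in L) /\
  exists q, [/\ q \in next_cls Z p, forall z, h z = h q -> z \notin L
             & ((p, p) \in Z) = ((q, q) \in Z)].

Definition togglable h L Z p :=
  [/\ encodes h Z, p \in L & splittable h L p \/ mergeable h L Z p].

Lemma toggle_bip h L Z p : togglable h L Z p -> bipartitional (toggle p L Z).
Proof.
case=> e pL [[r hr rL]|[KL [q [qN qL pq]]]].
  exact: encodes_bipartitional (encodes_toggle_split e hr rL).
exact: encodes_bipartitional (encodes_toggle_merge e KL qN pq).
Qed.

Lemma toggle_diag h L Z p x : togglable h L Z p ->
  ((x, x) \in toggle p L Z) = ((x, x) \in Z).
Proof.
case=> e pL [[r hr rL]|[KL [q [qN qL pq]]]].
  by rewrite (in_toggle_split _ _ e hr rL) eqxx !andbF.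
rewrite (in_toggle_merge _ _ e KL qN).
have [lt _] := in_next_cls _ _ e qN.
case: (h x =P h p) => [->|_]; last by rewrite andbF.
by case: eqP => // E; rewrite E ltnn in lt.
Qed.

(** Each move prepares the other: after a split the part outside [L] is the next block, and after a
    merge [q] witnesses that [L] cuts the block. *)
Lemma toggleK h L Z p : togglable h L Z p -> toggle p L (toggle p L Z) = Z.
Proof.
case=> e pL [[r hr rL]|[KL [q [qN qL pq]]]]; apply/setP => -[x y].
  have e' := encodes_toggle_split e hr rL.
  have KL' s : (2 * h s + ((h s == h p) && (s \notin L)) =
      2 * h p + ((h p == h p) && (p \notin L)))%N -> s \in L.
    by rewrite eqxx pL; case: (s \in L) => //; case: eqP => //=; lia.
  have rN : r \in next_cls (toggle p L Z) p.
    apply/(in_next_cls _ _ e'); rewrite hr eqxx pL rL; split=> [|w] /=; first by lia.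
    by case: (h w == h p) => /=; case: (w \in L) => /=; lia.
  rewrite (in_toggle_merge _ _ e' KL' rN) !(in_toggle_split _ _ e hr rL).
  rewrite hr eqxx pL rL /= (proj2 e x y); have := proj1 e x p.
  by rewrite !ifbE; lia.
have [lt adj] := in_next_cls _ _ e qN.
have e' := encodes_toggle_merge e KL qN pq.
have qL' := qL _ erefl.
have hq : (if h q == h q then h p else h q) = (if h p == h q then h p else h p).
  by rewrite eqxx if_same.
rewrite (in_toggle_split _ _ e' hq qL') (in_toggle_merge _ _ e KL qN).
have mg z : ((if h z == h q then h p else h z) == h p) = (h z == h q) || (h z == h p).
  by case: ifP; rewrite ?eqxx.
rewrite if_same !mg (proj2 e x y); have := proj1 e x p.
have := KL x; have := KL y; have := qL x; have := qL y; have := proj1 e x q; move: lt pq.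
by rewrite !ifbE; lia.
Qed.

Lemma toggle_diagE h L Z p : togglable h L Z p -> diag (toggle p L Z) = diag Z.
Proof. by move=> t; apply/setP => x; rewrite !inE (toggle_diag _ t). Qed.

Lemma rho_toggle_split h L Z p : encodes h Z -> p \in L -> splittable h L p ->
  if (p, p) \in Z then rho Z = (rho (toggle p L Z)).+1
  else rho (toggle p L Z) = (rho Z).+1.
Proof.
move=> e pL sp; have [r hr rL] := sp.
apply: (@rho_split _ _ h L p r) => // [x y|x y||].
- exact: encodes_sim e.
- rewrite (encodes_sim _ _ (encodes_toggle_split e hr rL)).
  case: (h x =P h p); case: (h y =P h p); case: (x \in L); case: (y \in L) => /=; lia.
- by case: e.
- by apply: (@toggle_diagE h); split=> //; left.
Qed.

Lemma rho_toggle_merge h L Z p : encodes h Z -> p \in L -> mergeable h L Z p ->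
  if (p, p) \in Z then rho (toggle p L Z) = (rho Z).+1
  else rho Z = (rho (toggle p L Z)).+1.
Proof.
move=> e pL mg; have t : togglable h L Z p by split=> //; right.
have [KL [q [qN qL pq]]] := mg.
have e' := encodes_toggle_merge e KL qN pq; have [lt _] := in_next_cls _ _ e qN.
(* The roles in [rho_split] are exchanged: the toggled relation is the coarse one and [Z] is its cut
   along [L]. *)
rewrite -(toggle_diag p t).
apply: (rho_split (h := fun x => if h x == h q then h p else h x) _ _ pL (qL q erefl)).
- by move=> x y; apply: encodes_sim e'.
- move=> x y; rewrite (encodes_sim _ _ e).
  have := KL x; have := KL y; have := qL x; have := qL y; rewrite if_same.
  case: (h x =P h q); case: (h y =P h q); case: (x \in L); case: (y \in L) => /=; lia.
- by rewrite eqxx if_same.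
- by case: e'.
- by rewrite (toggle_diagE t).
Qed.

Lemma odd_rho_toggle h L Z p : togglable h L Z p ->
  odd (rho (toggle p L Z)) = ~~ odd (rho Z).
Proof.
case=> e pL [sp|mg].
  by have := rho_toggle_split e pL sp; case: ifP => _ ->; rewrite /= ?negbK.
by have := rho_toggle_merge e pL mg; case: ifP => _ ->; rewrite /= ?negbK.
Qed.

Lemma toggle_sim h L Z p x y : togglable h L Z p -> h x != h p ->
    (forall q, ~ splittable h L p -> q \in next_cls Z p -> ((p, p) \in Z) = ((q, q) \in Z) -> h x != h q) ->
  sim (toggle p L Z) x y = sim Z x y.
Proof.
case=> e pL [[r hr rL]|[KL [q [qN qL pq]]]] xp xN.
  by rewrite /sim !(in_toggle_split _ _ e hr rL) (negbTE xp) /= andbF.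
have {}xN : h x != h q by apply: xN => // -[r /KL ->].
by rewrite /sim !(in_toggle_merge _ _ e KL qN) (negbTE xp) (negbTE xN) /= !andbF.
Qed.

(** * Replacing the relation inside an autonomous set *)

Definition autonomous B Z :=
  (forall x y z, x \notin B -> y \in B -> z \in B ->
     ((x, y) \in Z) = ((x, z) \in Z) /\ ((y, x) \in Z) = ((z, x) \in Z)) /\
  (forall x y, x \notin B -> y \in B -> ((x, y) \in Z) = ((y, x) \notin Z)).

Definition graft B W Z := [set xy : X * X |
  if (xy.1 \in B) && (xy.2 \in B) then xy \in W else xy \in Z].

Lemma in_graft B W Z x y : ((x, y) \in graft B W Z) =
  if (x \in B) && (y \in B) then (x, y) \in W else (x, y) \in Z.
Proof. by rewrite inE. Qed.

(** An autonomous set is a module that no block straddles: each outsider is strictly before or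
    strictly after all of [B], so no path leaves [B] and returns. *)
Lemma graft_transitive B W Z : autonomous B Z ->
  transitive_set Z -> transitive_set W -> transitive_set (graft B W Z).
Proof.
case=> au ex /transitive_setP tZ /transitive_setP tW; apply/transitive_setP => y x z.
rewrite /= !inE /=; have := tZ y x z; have := tW y x z; rewrite /= => tW' tZ'.
case: (boolP (x \in B)) => xB; case: (boolP (y \in B)) => yB;
  case: (boolP (z \in B)) => zB //=.
- by move=> _; have [_ ->] := au z x y zB xB yB.
- by rewrite (ex y z yB zB) => yx /negP[]; have [_ <-] := au y x z yB xB zB.
- by move=> + _; have [-> _] := au x y z xB yB zB.
Qed.

(** Complementation preserves autonomy and commutes with grafting. *)
Lemma graft_bipartitional B W Z : autonomous B Z ->
  bipartitional Z -> bipartitional W -> bipartitional (graft B W Z).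
Proof.
move=> au /andP[tZ cZ] /andP[tW cW]; apply/andP; split; first exact: graft_transitive.
suff -> : ~: graft B W Z = graft B (~: W) (~: Z).
  apply: graft_transitive => //; case: au => au ex; split=> [x y z xB yB zB|x y xB yB];
  rewrite !inE; last by rewrite (ex x y).
  by have [-> ->] := au x y z xB yB zB.
by apply/setP => xy; rewrite !inE; case: ifP.
Qed.

(** In [rho], [#|B|] irreflexive singleton blocks disappear, [#|B|] reflexive elements of weight 3
    appear, and one reflexive block is subtracted. The net change [2 * #|B| - 1] is odd. *)
Lemma rho_graft_setT B Z b : b \in B ->
    (forall x, x \in B -> (x, x) \notin Z) ->
    (forall x y, x \in B -> y \notin B -> ~~ sim Z x y) ->
    (forall x y, x \in B -> y \in B -> sim Z x y -> x = y) ->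
  ((rho (graft B setT Z)).+1 = rho Z + 2 * #|B|)%N.
Proof.
move=> bB nB sB sI; set Z' := graft B setT Z.
have out x y : (x \notin B) || (y \notin B) -> ((x, y) \in Z') = ((x, y) \in Z).
  by rewrite inE -negb_and => /negbTE ->.
have same x : x \notin B -> cls Z' x = cls Z x.
  by move=> xB; apply/setP => y; rewrite !inE /sim !out ?xB ?orbT.
have inB x : x \in B -> cls Z' x = B.
  move=> xB; apply/setP => y; rewrite inE.
  case: (boolP (y \in B)) => yB; first by rewrite /sim !inE /= xB yB.
  by rewrite /sim !out ?yB ?orbT //; apply: negbTE; exact: sB.
have sxx W x : x \in cls W x by rewrite inE /sim eqxx.
have dE : diag Z' = B :|: diag Z.
  by apply/setP => x; rewrite !inE /= andbb; case: ifP.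
have dis : [disjoint B & diag Z].
  by apply/pred0P => x /=; rewrite inE; case: (boolP (x \in B)) => //= /nB /negbTE.
have nd x : x \in diag Z -> x \notin B by rewrite inE => H; apply: contraL H => /nB.
have c1 : #|diag Z'| = (#|B| + #|diag Z|)%N.
  by rewrite dE cardsU (disjoint_setI0 dis) cards0 subn0.
have c2 : #|cls Z' @: diag Z'| = (#|cls Z @: diag Z|).+1.
  have -> : cls Z' @: diag Z' = B |: (cls Z @: diag Z).
    rewrite dE imsetU; congr (_ :|: _).
      apply/setP => A; rewrite inE; apply/imsetP/eqP => [[x /inB -> ->]|->] //.
      by exists b; rewrite ?inB.
    by apply: eq_in_imset => x /nd /same.
  rewrite cardsU1 (_ : B \notin _) //; apply/imsetP => -[x /nd xB BE].
  by case/negP: xB; rewrite BE.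
have c3 : #|cls Z @: ~: diag Z| = (#|cls Z' @: ~: diag Z'| + #|B|)%N.
  have -> : cls Z @: (~: diag Z) = (cls Z @: B) :|: (cls Z' @: (~: diag Z')).
    have -> : cls Z' @: (~: diag Z') = cls Z @: (~: diag Z').
      by apply: eq_in_imset => x; rewrite dE !inE => /norP[/same].
    rewrite -imsetU; have -> // : ~: diag Z = B :|: ~: diag Z'.
    apply/setP => x; rewrite dE !inE.
    by case: (boolP (x \in B)) => //= /nB.
  rewrite cardsU disjoint_setI0 ?cards0 ?subn0; last first.
    apply/pred0P => A; apply/negP => /andP[/imsetP[x xB ->] /imsetP[y]].
    rewrite dE !inE => /norP[yB _] E; case/negP: (sB x y xB yB).
    by have := sxx Z' y; rewrite -E inE.
  by rewrite card_in_imset 1?addnC // => x y xB yB E; apply: sI => //;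
     have := sxx Z y; rewrite -E inE.
have le1 : (#|cls Z @: diag Z| <= #|diag Z|)%N by apply: leq_imset_card.
have : (0 < #|B|)%N by rewrite card_gt0; apply/set0Pn; exists b.
rewrite /rho c1 c2 c3; move: le1; do 4!move: #|_|; lia.
Qed.

End Toggle.

(** * Regular intervals *)

Section Regular.
Variable X : finType.
Implicit Types (U V Z : {set X * X}) (x y : X).

(** Regularity is that of [[U, Z]], not of [[U, V]]. Plain sets are used so that [toggle] and
    [graft] apply directly. *)
Definition regular_between U V Z :=
  [&& bipartitional Z, U \subset Z, Z \subset V &
      [forall x in diag Z :\: diag U, cls U x == cls Z x]].

Lemma regular_betweenP U V Z :
  reflect [/\ bipartitional Z, forall x y, (x, y) \in U -> (x, y) \in Z,
              forall x y, (x, y) \in Z -> (x, y) \in V &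
              forall x y, (x, x) \in Z -> (x, x) \notin U -> sim Z x y = sim U x y]
          (regular_between U V Z).
Proof.
apply: (iffP and4P) => -[bZ UZ ZV reg]; split=> //.
- by move=> x y; apply: (subsetP UZ).
- by move=> x y; apply: (subsetP ZV).
- move=> x y xZ xU; move/forall_inP: reg => /(_ x); rewrite !inE xZ xU.
  by move=> /(_ isT)/eqP/setP/(_ y); rewrite !inE.
- by apply/subsetP => -[x y]; apply: UZ.
- by apply/subsetP => -[x y]; apply: ZV.
- apply/forall_inP => x; rewrite !inE => /andP[xU xZ].
  by apply/eqP/setP => y; rewrite !inE reg.
Qed.

Lemma regular_between_refl U V : bipartitional U -> U \subset V -> regular_between U V U.
Proof.
by move=> bU UV; apply/regular_betweenP; split=> // x y; exact: (subsetP UV).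
Qed.

(** The second clause is sharper than a change of parity: it gives an element one rank above [U],
    from which [rho] is shown to be the rank function. *)
Definition sign_reversing U V (f : {set X * X} -> {set X * X}) :=
  (forall Z, regular_between U V Z ->
     [/\ regular_between U V (f Z), f (f Z) = Z & odd (rho (f Z)) = ~~ odd (rho Z)]) /\
  rho (f U) = (rho U).+1.

(** * Toggling the separation of two consecutive reflexive blocks *)

Section Merge.
Variables (U V : {set X * X}) (p q : X).
Hypotheses (bU : bipartitional U) (bV : bipartitional V).
Hypotheses (pq : q \in next_cls U p) (Vqp : (q, p) \in V).
Hypotheses (Up : (p, p) \in U) (Uq : (q, q) \in U).

(** This set is closed downwards in [U], so a cut along it loses no pair of [U]. *)
Let L := [set z | (z, p) \in U].

(** In [U], and hence in [Z], every element is weakly before [p] or weakly after [q]. So the blocks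
    of [p] and [q] in [Z] coincide or are adjacent. *)
Lemma merge_cases Z (h := depth Z) : regular_between U V Z ->
  if (q, p) \in Z then h q = h p /\ q \notin L
  else [/\ forall r, h r = h p -> r \in L, q \in next_cls Z p &
           forall z, h z = h q -> z \notin L].
Proof.
case/regular_betweenP=> bZ UZ ZV reg.
have eU := bipartitional_encodes bU; have eZ := bipartitional_encodes bZ.
have [lt adj] := in_next_cls _ _ eU pq.
have [Upq Uqp] : (p, q) \in U /\ (q, p) \notin U.
  by move: pq; rewrite inE => /and3P[].
have Zp := UZ _ _ Up; have Zq := UZ _ _ Uq; have Zpq := UZ _ _ Upq.
rewrite (encodes_ler _ eZ) // in Zpq.
rewrite (encodes_ler _ eZ) // -/h.
case: leqP => Zqp.
  by rewrite inE; split=> //; apply/eqP; rewrite eqn_leq Zqp.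
have up r : (depth U p < depth U r)%N -> (h q <= h r)%N.
  move=> pr; rewrite -(encodes_lel _ eZ) //; apply: UZ.
  by rewrite (encodes_lel _ eU) // leqNgt; move: (adj r); rewrite pr.
have low r : (r, p) \in U = (depth U r <= depth U p)%N by apply: encodes_ler.
split.
- by move=> r rp; rewrite inE low leqNgt; apply/negP => /up; rewrite rp leqNgt Zqp.
- apply/(in_next_cls _ _ eZ); split=> // w; apply/negP => /andP[pw wq].
  case: (leqP (depth U w) (depth U p)) => [|/up]; last by rewrite leqNgt wq.
  by rewrite -low => /UZ; rewrite (encodes_ler _ eZ) // leqNgt pw.
- by move=> z zq; rewrite inE; apply/negP => /UZ;
     rewrite (encodes_ler _ eZ) // -/h zq leqNgt Zqp.
Qed.

Lemma merge_togglable Z : regular_between U V Z ->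
  togglable (depth Z) L Z p.
Proof.
move=> rZ; have cZ := merge_cases rZ; case/regular_betweenP: rZ => bZ UZ ZV reg.
split; rewrite ?inE //; first exact: bipartitional_encodes.
case: ifP cZ => _ [] => [|? ?]; first by left; exists q.
by right; split=> //; exists q; rewrite !UZ.
Qed.

Lemma merge_regular Z : regular_between U V Z ->
  regular_between U V (toggle p L Z).
Proof.
move=> rZ; have t := merge_togglable rZ; have cZ := merge_cases rZ.
case/regular_betweenP: rZ => bZ UZ ZV reg.
have eU := bipartitional_encodes bU; have eZ := bipartitional_encodes bZ.
have tr : transitive [rel x y | (x, y) \in V] by apply/transitive_setP; case/andP: bV.
have trU : transitive [rel x y | (x, y) \in U] by apply/transitive_setP; case/andP: bU.
have Zp := UZ _ _ Up; have Zq := UZ _ _ Uq.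
have dK : forall x y, depth Z x = depth Z y -> ((x,x) \in Z) = ((y,y) \in Z) := proj1 eZ.
(* By regularity, a newly reflexive block is a block of [U], so it contains neither [p] nor [q] and
   is left alone by the toggle. *)
have notU x y : (x, x) \in Z -> (x, x) \notin U -> (y, y) \in U -> depth Z x != depth Z y.
  move=> xZ xU yU; rewrite -(encodes_sim _ _ eZ) reg // (encodes_sim _ _ eU).
  by apply: contraNneq xU => /(proj1 eU) ->.
apply/regular_betweenP; split; first exact: (toggle_bip t).
- move=> x y xy; case: ifP cZ => [_ [hr rL]|_ [KL qN qL]].
    rewrite (in_toggle_split _ _ eZ hr rL); case: and3P => [[_ _]|_]; last exact: UZ.
    rewrite !inE; case: (boolP ((x, p) \in U)) => //= xp; rewrite negbK => yp.
    by case/negP: xp; exact: trU xy yp.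
  by rewrite (in_toggle_merge _ _ eZ KL qN); case: ifP => // _; exact: UZ.
- move=> x y; case: ifP cZ => [_ [hr rL]|_ [KL qN qL]].
    rewrite (in_toggle_split _ _ eZ hr rL); case: and3P => [[/eqP xp /eqP yp _] _|_]; last exact: ZV.
    by apply: ZV; rewrite (encodes_ler _ eZ) ?xp ?yp // (dK y p).
  have [lt _] := in_next_cls _ _ eZ qN.
  rewrite (in_toggle_merge _ _ eZ KL qN).
  case: ifP => [/orP[]/andP[/eqP xp /eqP yp] _|_]; last exact: ZV.
    by apply: ZV; rewrite (encodes_lel _ eZ) ?(dK x p) // xp yp ltnW.
  (* A pair from the block of [q] back to that of [p] lies in [V] by way of [(q, p)]. *)
  have xq : (x, q) \in V by apply: ZV; rewrite (encodes_ler _ eZ) // xp.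
  have py : (p, y) \in V by apply: ZV; rewrite (encodes_lel _ eZ) // yp.
  by apply: (tr q) => //=; apply: (tr p) => //=.
- move=> x y; rewrite (toggle_diag _ t) => xZ xU.
  rewrite -reg //; apply: (toggle_sim _ t); first exact: notU.
  move=> q' nsp q'N _; case: ifP cZ => [_ [hr rL]|_ [KL qN qL]].
    by case: nsp; exists q.
  by move: q'N; rewrite (next_cls_eq _ eZ qN) => /eqP ->; exact: notU.
Qed.

Lemma merge_sign_reversing : U \subset V -> sign_reversing U V (toggle p L).
Proof.
move=> UV; split=> [Z rZ|].
  have t := merge_togglable rZ; split; first exact: merge_regular.
    exact: (toggleK t).
  exact: (odd_rho_toggle t).
have rU : regular_between U V U.
  apply/regular_betweenP; split=> // x y; exact: (subsetP UV).
have := merge_cases rU; have -> : (q, p) \in U = false.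
  by apply: negbTE; move: pq; rewrite inE => /and3P[].
move=> [KL qN qL]; have := @rho_toggle_merge X (depth U) L U p.
rewrite Up => -> //; first exact: bipartitional_encodes.
  by rewrite inE.
by split=> //; exists q; rewrite Up Uq.
Qed.

End Merge.
End Regular.

(** * Toggling inside an irreflexive block [B] of [U] *)

Section Block.
Variable X : finType.
Implicit Types (Z W : {set X * X}) (x y z p q : X) (h : X -> nat) (L D : {set X}).
Variables (U V : {set X * X}) (b : X).
Hypotheses (bU : bipartitional U) (bV : bipartitional V) (UV : U \subset V).
Hypotheses (Ub : (b, b) \notin U).

Let B := cls U b.
Let bB : b \in B. Proof. by rewrite inE /sim. Qed.
Let eU : encodes (depth U) U. Proof. exact: bipartitional_encodes. Qed.
Let inB x : (x \in B) = (depth U b == depth U x).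
Proof. by rewrite inE (encodes_sim _ _ eU). Qed.

Let UB x y : x \in B -> y \in B -> (x, y) \notin U.
Proof.
rewrite !inB => /eqP bx /eqP yb.
by rewrite (proj2 eU) -bx yb ltnn eqxx /= -(proj1 eU _ _ bx).
Qed.

(** If [Z] related [x] and [y] both ways, [y] would become reflexive with a class larger than [B],
    against regularity. As [U] has exactly one of the two pairs, [Z] adds nothing. *)
Lemma block_out Z x y : regular_between U V Z -> x \notin B -> y \in B ->
  [/\ ((x, y) \in Z) = ((x, y) \in U), ((y, x) \in Z) = ((y, x) \in U)
    & ((x, y) \in U) = ((y, x) \notin U)].
Proof.
case/regular_betweenP=> bZ UZ _ reg xB yB.
have eZ := bipartitional_encodes bZ.
have Uxy : ((x, y) \in U) = ((y, x) \notin U).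
  have := yB; rewrite inB => /eqP yb; move: xB; rewrite inB yb eq_sym.
  by rewrite -(encodes_sim _ _ eU) /sim => /negPf; case: (_ \in U); case: (_ \in U).
have Zxy : ~~ (((x, y) \in Z) && ((y, x) \in Z)).
  apply/negP => /andP[xy yx]; case/negP: xB.
  have E : depth Z y = depth Z x.
    by apply/eqP; rewrite -(encodes_sim _ _ eZ) /sim xy yx.
  have yy : (y, y) \in Z by move: yx; rewrite (proj2 eZ) E ltnn eqxx.
  have := reg y x yy (UB yB yB); rewrite (encodes_sim _ _ eZ) E eqxx.
  by rewrite inE (encodes_sim _ _ eU) (encodes_sim _ _ eU); move: yB; rewrite inB => /eqP <-.
move: Zxy (UZ x y) (UZ y x); rewrite Uxy.
by case: (_ \in Z); case: (_ \in Z); case: (_ \in U) => //= _ H1 H2;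
  try (by have := H1 isT); try (by have := H2 isT).
Qed.

Lemma block_autonomous Z : regular_between U V Z -> autonomous B Z.
Proof.
move=> rZ; split=> [x y z xB yB zB|x y xB yB]; last first.
  by case: (block_out rZ xB yB) => -> ->.
case: (block_out rZ xB yB) => -> -> _; case: (block_out rZ xB zB) => -> -> _.
move: yB zB; rewrite !inB => /eqP yB /eqP zB.
move: xB; rewrite inB => /negbTE xB.
rewrite (proj2 eU x y) (proj2 eU x z) (proj2 eU y x) (proj2 eU z x) -yB -zB.
by rewrite [depth U x == _]eq_sym xB.
Qed.

Lemma block_full Z x y : regular_between U V Z -> (b, b) \in Z ->
  x \in B -> y \in B -> (x, y) \in Z.
Proof.
case/regular_betweenP=> bZ UZ _ reg Zb; have eZ := bipartitional_encodes bZ.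
rewrite !inE -!reg // !(encodes_sim _ _ eZ) => /eqP bx /eqP yb.
by rewrite (encodes_ler _ eZ) -?bx ?yb // -(proj1 eZ _ _ yb).
Qed.

(** By regularity a reflexive [x] would have all of [B] as its class, including [b]. *)
Lemma block_empty Z x : regular_between U V Z -> (b, b) \notin Z ->
  x \in B -> (x, x) \notin Z.
Proof.
case/regular_betweenP=> bZ UZ _ reg Zb xB; apply: contra Zb => xZ.
have eZ := bipartitional_encodes bZ.
have := reg x b xZ (UB xB xB); rewrite (encodes_sim _ _ eU).
move: xB; rewrite inB eq_sym => ->; rewrite (encodes_sim _ _ eZ) => /eqP E.
by rewrite -(proj1 eZ _ _ E).
Qed.

(** Common core of the two involutions in [B]. The element [y0] guarantees something to split from
    or to merge with, and the last hypothesis keeps the pairs added by a split inside [V]. The last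
    two conclusions serve to recompute [misplaced]. *)
Lemma block_toggle Z p L y0 (T := toggle p L Z) :
    regular_between U V Z -> (b, b) \notin Z ->
    p \in L -> L \subset B -> (forall y, y \in L -> sim Z p y) ->
    y0 \in B -> y0 \notin L -> (y0, p) \notin Z ->
    (forall l w, l \in L -> w \in B -> w \notin L -> (l, w) \in V) ->
  [/\ togglable (depth Z) L Z p, regular_between U V T,
      forall x y, x \notin L -> ((x, y) \in T) = ((x, y) \in Z) &
      forall x y, y \notin L -> (y, p) \notin Z -> (y, x) \in Z -> (p, x) \in Z ->
        (p, x) \in T].
Proof.
move=> rZ Zb pL LB simL y0B y0L y0p LV.
have [aut exB] := block_autonomous rZ.
have pB := subsetP LB _ pL.
have := rZ; case/regular_betweenP=> bZ UZ ZV reg; have eZ := bipartitional_encodes bZ.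
have nB x : x \in B -> (x, x) \notin Z by apply: block_empty.
have simB x y : x \in B -> depth Z x = depth Z y -> y \in B.
  move=> xB E; apply/negPn/negP => yB; have := exB y x yB xB.
  by have := encodes_sim x y eZ; rewrite E eqxx /sim => /eqP ->; case: (_ \in Z).
have simp y : y \in L -> depth Z p = depth Z y.
  by move=> /simL; rewrite (encodes_sim _ _ eZ) => /eqP.
have ltB x y : y \in B -> ((x, y) \in Z) = (depth Z x < depth Z y)%N.
  move=> yB; rewrite (proj2 eZ); case: ltngtP => //= E.
  by rewrite (proj1 eZ _ _ E); apply/negbTE/nB.
have ltBl x y : x \in B -> ((x, y) \in Z) = (depth Z x < depth Z y)%N.
  by move=> xB; rewrite (proj2 eZ) (negbTE (nB x xB)) andbF orbF.
have dich : (exists2 r, depth Z r = depth Z p & r \notin L) \/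
  [/\ forall r, depth Z r = depth Z p -> r \in L &
    exists q, [/\ q \in next_cls Z p, q \in B & (depth Z p < depth Z q)%N]].
  case: (boolP [exists r, (depth Z r == depth Z p) && (r \notin L)]) => [/existsP[r /andP[/eqP]]|].
    by left; exists r.
  rewrite negb_exists => /forallP H; right.
  have KL r : depth Z r = depth Z p -> r \in L.
    by move=> /eqP rp; move: (H r); rewrite rp negbK.
  split=> //.
  (* Since [L] exhausts the block of [p], [y0] comes strictly later; the lowest such element of [B]
     is the merging partner. *)
  have P0 : (y0 \in B) && (depth Z p < depth Z y0)%N.
    rewrite y0B; move: y0p; rewrite ltBl // -leqNgt leq_eqVlt => /orP[/eqP/esym/KL|//].
    by rewrite (negbTE y0L).
  case: (@arg_minnP _ y0 (fun z => (z \in B) && (depth Z p < depth Z z)%N) (depth Z) P0).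
  move=> q /andP[qB pq] qmin; exists q; split=> //.
  apply/(in_next_cls _ _ eZ); split=> // w; apply/negP => /andP[pw wq].
  case: (boolP (w \in B)) => wB; first by have := qmin w; rewrite wB pw leqNgt wq => /(_ isT).
  (* An outsider lies on the same side of [p] and [q], hence not between them. *)
  have := exB w q wB qB; have [_ <-] := aut w p q wB pB qB.
  by rewrite ltB // wq ltBl // pw.
have t : togglable (depth Z) L Z p.
  split=> //; case: dich => [[r rp rL]|[KL [q [qN qB pq]]]]; first by left; exists r.
  right; split=> //; exists q; split=> //.
    by move=> z zq; apply/negP => /simp E; move: pq; rewrite -zq E ltnn.
  by rewrite (negbTE (nB _ pB)) (negbTE (nB _ qB)).
have Tsame x y : x \notin L -> ((x, y) \in T) = ((x, y) \in Z).
  move=> xL; case: dich => [[r rp rL]|[KL [q [qN qB pq]]]].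
    rewrite (in_toggle_split _ _ eZ rp rL); case: and3P => // -[/eqP xp /eqP yp _].
    by rewrite (negbTE xL) ltB ?xp ?yp ?ltnn //; apply: simB (esym yp).
  rewrite (in_toggle_merge _ _ eZ KL qN).
  case: (depth Z x =P depth Z p) => [/KL|_]; first by rewrite (negbTE xL).
  case: (depth Z y =P depth Z p) => [yp|_]; last by rewrite andbF.
  rewrite andbT /=; case: eqP => // xq.
  rewrite (negbTE (nB _ pB)) ltB ?yp ?xq; last exact: simB (esym yp).
  by rewrite ltnNge ltnW.
split=> //; last first.
  move=> x y yL yp yx px; case: dich => [[r rp rL]|[KL [q [qN qB pq]]]].
    by rewrite (in_toggle_split _ _ eZ rp rL); case: and3P.
  rewrite (in_toggle_merge _ _ eZ KL qN) eqxx /=; have [_ adj] := in_next_cls _ _ eZ qN.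
  rewrite [depth Z p == depth Z q]ltn_eqF // orbF.
  (* The merge would only drop [(p, x)] if [x] were in the block of [q], but then [y] would lie
     strictly between. *)
  case: eqP => // xq; case/negP: (adj y).
  have -> /= : (depth Z y < depth Z q)%N.
    by rewrite -xq -ltB //; exact: simB (esym xq).
  rewrite andbT ltn_neqAle; move: yp; rewrite ltB // -leqNgt => ->.
  by rewrite andbT; apply: contra yL => /eqP/esym/KL.
apply/regular_betweenP; split.
- exact: (toggle_bip t).
- move=> x y xy; have Zxy := UZ _ _ xy.
  case: dich => [[r rp rL]|[KL [q [qN qB pq]]]].
    rewrite (in_toggle_split _ _ eZ rp rL); case: and3P => // -[/eqP xp /eqP yp _].
    by move: Zxy; rewrite ltB ?xp ?yp ?ltnn //; apply: simB (esym yp).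
  rewrite (in_toggle_merge _ _ eZ KL qN); case: ifP => // /orP[]/andP[/eqP xp /eqP yp].
    by case/negP: (UB (simB _ _ pB (esym xp)) (simB _ _ qB (esym yp))).
  by case/negP: (UB (simB _ _ qB (esym xp)) (simB _ _ pB (esym yp))).
- move=> x y; case: dich => [[r rp rL]|[KL [q [qN qB pq]]]].
    rewrite (in_toggle_split _ _ eZ rp rL); case: and3P => [[_ /eqP yp]|_]; last exact: ZV.
    move=> + xL; rewrite xL => yL; apply: LV => //; first exact: (simB p y pB (esym yp)).
  rewrite (in_toggle_merge _ _ eZ KL qN); case: ifP => [_|_]; last exact: ZV.
  by rewrite (negbTE (nB _ pB)).
- move=> x y; rewrite (toggle_diag _ t) => xZ xU.
  rewrite -reg //; apply: (toggle_sim _ t).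
    by apply: contraL xZ => /eqP E; apply/nB/(simB _ _ pB (esym E)).
  move=> q _ _ Epq; apply: contraL xZ => /eqP E.
  by rewrite (proj1 eZ _ _ E) -Epq; apply: nB.
Qed.

(** [L] is the first part of [V] in [B], and it is irreflexive. [V], hence [Z], has no pair inside
    it, so it sits in a single block of [Z]. *)
Lemma split_first_sign_reversing a : a \in B ->
    (forall y, y \in B -> (y, a) \notin V) ->
    (exists2 y, y \in B & (a, y) \in V) ->
  sign_reversing U V (toggle a [set y in B | (a, y) \notin V]).
Proof.
move=> aB aV [y1 y1B ay1]; set L := [set y in B | _].
have eV := bipartitional_encodes bV.
have aL : a \in L by rewrite inE aB aV.
have y1L : y1 \notin L by rewrite inE ay1 andbF.
split=> [Z rZ|]; last first.
  have := @rho_toggle_split X (depth U) L U a eU aL.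
  have := inB a; rewrite aB => /esym/eqP E; rewrite -(proj1 eU _ _ E) (negbTE Ub); apply.
  by exists y1 => //; rewrite -E; apply/eqP; rewrite eq_sym -inB.
have [_ _ ZV _] := regular_betweenP _ _ _ rZ.
have Zb : (b, b) \notin Z.
  by apply: contra (aV a aB) => Zb; apply: ZV; apply: (block_full rZ Zb).
have [|y||l w|t rT _ _] := @block_toggle Z a L y1 rZ Zb aL _ _ y1B y1L.
- by apply/subsetP => y; rewrite inE => /andP[].
- rewrite inE => /andP[yB ay]; rewrite /sim.
  rewrite (negbTE (contra (ZV a y) ay)).
  by rewrite (negbTE (contra (ZV y a) (aV y yB))).
- by apply: contra (aV y1 y1B); apply: ZV.
- rewrite inE => /andP[lB al] wB; rewrite inE wB /= negbK; move: al.
  rewrite (proj2 eV a l) (proj2 eV a w) (negbTE (aV a aB)) !andbF !orbF -leqNgt => la aw.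
  by rewrite (proj2 eV) (leq_ltn_trans la aw).
split=> //; first exact: (toggleK t).
exact: (odd_rho_toggle t).
Qed.

(** * The case where the first part of [V] in [B] is reflexive *)

Section First.
Variable a : X.
Hypotheses (aB : a \in B) (aV : forall y, y \in B -> (a, y) \in V).

(* Any injection minimal at [a] would do: an element other than [a] is toggled
   only if all of [B] precedes [a] in [Z], and then [V] contains [B * B]. *)
Let r x : nat := if x == a then 0%N else (enum_rank x).+1.
Let r_inj : injective r.
Proof.
move=> x y; rewrite /r; case: eqP => [->|_]; case: eqP => [->|_] // [] /val_inj.
exact: enum_rank_inj.
Qed.

(** For regular [Z] this is empty only if [B] is ordered linearly by decreasing label or is one
    reflexive block. *)
Definition misplaced Z :=
  [set x in B | [exists y in B, (r x < r y)%N && ((y, x) \notin Z)]].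

Definition descending : {set X * X} := [set xy | (r xy.2 < r xy.1)%N].

Definition is_first_misplaced Z x :=
  (x \in misplaced Z) && [forall y in misplaced Z, (r x <= r y)%N].

(** When nothing is misplaced, [(b, b)] tells which of the two exceptional relations is present, and
    they are exchanged. *)
Definition block_involution Z :=
  if [pick x | is_first_misplaced Z x] is Some p then toggle p [set p] Z
  else graft B (if (b, b) \in Z then descending else setT) Z.

Lemma descending_bipartitional : bipartitional descending.
Proof.
by apply/andP; split; apply/transitive_setP => y x z; rewrite /= !inE /=; lia.
Qed.

Lemma block_involution_some Z p : is_first_misplaced Z p -> block_involution Z = toggle p [set p] Z.
Proof.
rewrite /block_involution; case: pickP => [x|->//] /andP[xF /forall_inP xm] /andP[pF /forall_inP pm].
by have -> : x = p by apply: r_inj; apply/eqP; rewrite eqn_leq xm ?pm.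
Qed.

Lemma block_involution_none Z : misplaced Z = set0 ->
  block_involution Z = graft B (if (b, b) \in Z then descending else setT) Z.
Proof.
by rewrite /block_involution => F0; case: pickP => [x|//]; rewrite /is_first_misplaced F0 inE.
Qed.

Lemma misplacedP Z : misplaced Z = set0 \/ exists p, is_first_misplaced Z p.
Proof.
case: (set_0Vmem (misplaced Z)) => [|[x xF]]; [by left|right].
case: (arg_minnP r xF) => p pF pm; exists p.
by apply/andP; split=> //; apply/forall_inP.
Qed.

(** Only pairs starting at [p] change: the witness against [p] survives and no smaller label becomes
    misplaced, so the second application chooses [p] again. *)
Lemma misplaced_toggle Z p : regular_between U V Z -> is_first_misplaced Z p ->
  let T := toggle p [set p] Z in
  [/\ togglable (depth Z) [set p] Z p, regular_between U V T & is_first_misplaced T p].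
Proof.
move=> rZ /andP[]; rewrite inE => /andP[pB /exists_inP[y0 y0B /andP[py0 y0p]]] /forall_inP pm.
have [_ _ ZV _] := regular_betweenP _ _ _ rZ.
have eV := bipartitional_encodes bV.
have early x y : x \in B -> y \in B -> (r x < r p)%N -> (r x < r y)%N -> (y, x) \in Z.
  move=> xB yB xp xy; apply: contraLR xp => yx; rewrite -leqNgt; apply: pm.
  by rewrite inE xB; apply/exists_inP; exists y; rewrite ?xy.
have neq x y : (r x < r y)%N -> y \notin [set x].
  by rewrite inE; apply: contraL => /eqP ->; rewrite ltnn.
have Zb : (b, b) \notin Z.
  by apply: contra y0p => Zb; apply: (block_full rZ Zb).
have [|||l w|t rT Tout Tin] := @block_toggle Z p [set p] y0 rZ Zb _ _ _ y0B (neq _ _ py0) y0p.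
- by rewrite inE.
- by rewrite sub1set.
- by move=> y; rewrite inE => /eqP ->; rewrite /sim eqxx.
(* As [a] has the least label, [p] is [a] or precedes [a] in [Z]; and [a] precedes all of [B] in
   [V]. *)
- rewrite inE => /eqP -> wB _; case: (p =P a) => [->|/eqP pa]; first exact: aV.
  have pV : (p, a) \in V.
    by apply: ZV; apply: early => //; rewrite /r eqxx (negbTE pa).
  have tV := transitive_setP _ (proj1 (andP bV)).
  exact: tV pV (aV wB).
split=> //; apply/andP; split.
  rewrite inE pB; apply/exists_inP; exists y0 => //.
  by rewrite py0 Tout // neq.
apply/forall_inP => x; rewrite inE => /andP[xB /exists_inP[y yB /andP[xy yx]]].
rewrite leqNgt; apply/negP => xp; case/negP: yx.
have Zyx := early x y xB yB xp xy.
case: (y =P p) => [yp|/eqP yp]; last by rewrite Tout // inE.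
rewrite yp in Zyx *.
(* The element [y0] precedes [x] but not [p], so merging [p] with the next block does not reach
   [x]. *)
apply: (Tin x y0) => //; first exact: neq.
by apply: early => //; apply: ltn_trans py0.
Qed.

(** Here [a] is last in [Z] and first in [V], so [V] contains all pairs of [B] and the block may be
    made reflexive. *)
Lemma block_involution_full Z : regular_between U V Z -> misplaced Z = set0 ->
    (b, b) \notin Z ->
  let T := graft B setT Z in
  [/\ regular_between U V T, (b, b) \in T, misplaced T = set0,
      graft B descending T = Z & (rho T).+1 = (rho Z + 2 * #|B|)%N].
Proof.
move=> rZ F0 Zb T; have au := block_autonomous rZ.
have [bZ UZ ZV reg] := regular_betweenP _ _ _ rZ.
have lt x y : x \in B -> y \in B -> (r x < r y)%N -> (y, x) \in Z.
  move=> xB yB xy; apply/negPn/negP => yx; have := in_set0 x.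
  by rewrite -F0 inE xB => /exists_inP[]; exists y; rewrite ?xy.
have nB x : x \in B -> (x, x) \notin Z by apply: (block_empty rZ).
have tZ := transitive_setP _ (proj1 (andP bZ)).
have tV := transitive_setP _ (proj1 (andP bV)).
have ZE x y : x \in B -> y \in B -> ((x, y) \in Z) = (r y < r x)%N.
  move=> xB yB; case: (ltngtP (r y) (r x)) => [/lt->//|xy|/r_inj->].
    apply: contraNF (nB x xB) => /tZ; apply; exact: lt.
  exact/negbTE/nB.
have BV x y : x \in B -> y \in B -> (x, y) \in V.
  move=> xB yB; apply: (tV a) => /=; last exact: aV.
  case: (x =P a) => [->|/eqP xa]; first exact: aV.
  by apply/ZV/lt => //; rewrite /r eqxx (negbTE xa).
have out x y : x \notin B -> sim T x y = sim Z x y /\ sim T y x = sim Z y x.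
  by move=> /negbTE xB; rewrite /sim !in_graft xB !andbF.
have simBZ x y : x \in B -> y \notin B -> ~~ sim Z x y.
  by move=> xB yB; rewrite /sim ((proj2 au) y x yB xB); case: (_ \in Z).
split.
- apply/regular_betweenP; split.
  + apply: graft_bipartitional => //; apply/andP; split; apply/transitive_setP => y x z;
    by rewrite /= !inE.
  + by move=> x y /UZ xy; rewrite in_graft in_setT xy if_same.
  + by move=> x y; rewrite in_graft; case: andP => [[xB yB] _|_]; [exact: BV|exact: ZV].
  + move=> x y; case: (boolP (x \in B)) => xB; last first.
      by rewrite in_graft (negbTE xB) => xZ xU; case: (out x y xB) => -> _; exact: reg.
    move=> _ _; have bx := xB; rewrite inB in bx.
    rewrite (encodes_sim _ _ eU) -(eqP bx) -inB.
    case: (boolP (y \in B)) => yB; first by rewrite /sim !in_graft xB yB !in_setT.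
    by case: (out y x yB) => _ ->; apply/negbTE/simBZ.
- by rewrite in_graft bB in_setT.
- apply/setP => x; rewrite inE in_set0; apply/negP => /andP[xB /exists_inP[y yB]].
  by rewrite in_graft xB yB in_setT andbF.
- apply/setP => -[x y]; rewrite in_graft; case: ifP => [/andP[xB yB]|xyB].
    by rewrite inE ZE.
  by rewrite in_graft xyB.
- apply: (@rho_graft_setT X B Z b) => // x y xB yB; rewrite /sim !ZE // => E.
  by apply: r_inj; move: E; case: ltngtP.
Qed.

Lemma block_involution_linear Z : regular_between U V Z -> (b, b) \in Z ->
  let T := graft B descending Z in
  [/\ regular_between U V T, (b, b) \notin T, misplaced T = set0 & graft B setT T = Z].
Proof.
move=> rZ Zb T; have au := block_autonomous rZ.
have [bZ UZ ZV reg] := regular_betweenP _ _ _ rZ.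
have full x y : x \in B -> y \in B -> (x, y) \in Z by apply: (block_full rZ Zb).
split.
- apply/regular_betweenP; split.
  + by apply: graft_bipartitional => //; exact: descending_bipartitional.
  + move=> x y xy; rewrite in_graft; case: andP => [[xB yB]|_]; last exact: UZ.
    have := reg b b; move: xB yB; rewrite !inB => /eqP bx /eqP yb _.
    by move: xy; rewrite (proj2 eU) -bx yb ltnn eqxx /= -(proj1 eU _ _ bx) (negbTE Ub).
  + move=> x y; rewrite in_graft; case: andP => [[xB yB] _|_ /ZV//].
    by apply: ZV; exact: full.
  + move=> x y; rewrite in_graft; case: (boolP (x \in B)) => xB /=.
      by rewrite inE /= ltnn.
    by move=> xZ xU; rewrite -reg // /sim !in_graft (negbTE xB) andbF.
- by rewrite in_graft bB inE ltnn.
- apply/setP => x; rewrite inE in_set0; apply/negP => /andP[xB /exists_inP[y yB]].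
  by rewrite in_graft xB yB inE /= => /andP[->].
- apply/setP => -[x y]; rewrite in_graft; case: ifP => [/andP[xB yB]|xyB].
    by rewrite in_setT full.
  by rewrite in_graft xyB.
Qed.

Lemma block_involution_sign_reversing : sign_reversing U V block_involution.
Proof.
split=> [Z rZ|].
  case: (misplacedP Z) => [F0|[p pF]]; last first.
    have [t rT pT] := misplaced_toggle rZ pF.
    rewrite (block_involution_some pF); split=> //; last exact: (odd_rho_toggle t).
    by rewrite (block_involution_some pT) (toggleK t).
  have oddF m n k : (m.+1 = n + 2 * k)%N -> odd m = ~~ odd n.
    by move=> /(congr1 odd); rewrite /= oddD oddM /= addbF => <-; rewrite negbK.
  rewrite (block_involution_none F0); case: ifP => Zb.
    have [rT Tb FT TZ] := block_involution_linear rZ Zb.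
    split=> //; first by rewrite (block_involution_none FT) (negbTE Tb).
    have [_ _ _ _] := block_involution_full rT FT Tb; rewrite TZ => /oddF ->.
    by rewrite negbK.
  have [rT Tb FT TZ rhoT] := block_involution_full rZ F0 (negbT Zb).
  split=> //; first by rewrite (block_involution_none FT) Tb.
  exact: oddF rhoT.
have rU := regular_between_refl bU UV.
case: (misplacedP U) => [F0|[p pF]].
  rewrite (block_involution_none F0) (negbTE Ub).
  have [_ _ _ _] := block_involution_full rU F0 Ub.
  (* [U] has no pair inside [B], so two elements would give a misplaced one; for a singleton,
     [2 * #|B| - 1] is 1. *)
  suff -> : #|B| = 1%N by rewrite muln1 addn2 => -[].
  apply/eqP/cards1P; exists b; apply/setP => x; rewrite inE.
  apply/idP/eqP => [xB|->//]; apply: r_inj.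
  have lt y z : y \in B -> z \in B -> ~~ (r y < r z)%N.
    move=> yB zB; apply/negP => yz; have := in_set0 y.
    rewrite -F0 inE yB => /exists_inP[]; exists z; rewrite // yz /=.
    move: yB zB; rewrite !inB => /eqP yB /eqP zB.
    by rewrite (proj2 eU) -yB zB ltnn eqxx -(proj1 eU b z zB).
  by apply/eqP; rewrite eqn_leq leqNgt lt // leqNgt lt.
have [t _ _] := misplaced_toggle rU pF; rewrite (block_involution_some pF).
case/andP: pF; rewrite inE => /andP[pB /exists_inP[y yB /andP[py _]]] _.
have pU : (p, p) \notin U.
  by have := pB; rewrite inB => /eqP/(proj1 eU) <-.
have := @rho_toggle_split X (depth U) [set p] U p eU; rewrite (negbTE pU); apply.
  by rewrite inE.
exists y; last by rewrite inE; apply: contraTneq py => ->; rewrite ltnn.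
by move: pB yB; rewrite !inB => /eqP <- /eqP <-.
Qed.
End First.
End Block.

(** * The rank function and the Moebius function of [Bip X] *)

Section Main.
Variable X : finType.

Lemma exists_sign_reversing (U V : {set X * X}) :
  bipartitional U -> bipartitional V -> U \proper V ->
  exists f, sign_reversing U V f.
Proof.
move=> bU bV /properP[UV [[x y] xyV xyU]].
have eU := bipartitional_encodes bU; have eV := bipartitional_encodes bV.
case: (boolP [exists b, ((b, b) \notin U) &&
  [exists y in cls U b, [exists z in cls U b, (y, z) \in V]]]).
  case/existsP=> b /andP[Ub /exists_inP[y1 y1B /exists_inP[y2 y2B y12]]].
  have bB : b \in cls U b by rewrite inE /sim.
  (* [a] lies in the first part of [V] in the block; its reflexivity decides between the two
     involutions. *)
  case: (arg_minnP (depth V) bB) => a aB amin.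
  case: (boolP ((a, a) \in V)) => aa.
    exists (block_involution U b a); apply: block_involution_sign_reversing => // z /amin.
    by rewrite -(encodes_lel _ eV).
  eexists; apply: (split_first_sign_reversing bU bV Ub aB) => [z zB|].
    rewrite (proj2 eV); have := amin z zB; case: ltngtP => //= E _.
    by rewrite (proj1 eV _ _ E).
  exists y2 => //; move: y12; rewrite (proj2 eV y1) (proj2 eV a) (negbTE aa) andbF orbF.
  have le := amin y1 y1B; case/orP=> [|/andP[/eqP <- y11]]; first exact: leq_ltn_trans.
  by rewrite ltn_neqAle le andbT; apply: contraNneq aa => /(proj1 eV) ->.
rewrite negb_exists => /forallP noblock.
have diagV b z : (b, b) \notin U -> sim U b z -> (b, z) \notin V.
  move=> Ub bz; have := noblock b; rewrite Ub /=; apply: contra => bzV.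
  by apply/exists_inP; exists b; rewrite ?inE /sim //; apply/exists_inP; exists z; rewrite ?inE.
(* Otherwise [x] and [y] would share an irreflexive block of [U], which [diagV] excludes; so [V]
   reverses a strict pair of [U]. *)
have yxU : (y, x) \in U.
  apply: contraT => yxU; suff: (x, y) \notin V by rewrite xyV.
  apply: diagV.
    apply: contra xyU => xx; rewrite (encodes_lel _ eU) // leqNgt.
    by rewrite -(encodes_lt _ _ eU) (negbTE yxU).
  by rewrite /sim (negbTE xyU) (negbTE yxU).
(* A reversed pair at least distance is consecutive: for [w] strictly between, [(w, p)] is in [V]
   through [q], and [(p, w)] is closer. *)
pose P (e : X * X) := [&& e \in U, (e.2, e.1) \notin U & (e.2, e.1) \in V].
have P0 : P (y, x) by apply/and3P.
case: (arg_minnP (fun e => (depth U e.2 - depth U e.1)%N) P0) => -[p q] /= /and3P[pqU qpU qpV] mn.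
have UVs u v : (u, v) \in U -> (u, v) \in V by apply: (subsetP UV).
have tV := transitive_setP _ (proj1 (andP bV)).
have lt : (depth U p < depth U q)%N by rewrite -(encodes_lt _ _ eU) pqU.
have dp z : (z, z) \in V -> (z, z) \in U.
  by apply: contraLR => /diagV; apply; rewrite /sim.
exists (toggle p [set z | (z, p) \in U]); apply: (@merge_sign_reversing _ _ _ p q) => //.
- apply/(in_next_cls _ _ eU); split=> // w; apply/negP => /andP[pw wq].
  have := mn (p, w); rewrite /P /=.
  move: (pw) (wq); rewrite -!(encodes_lt _ _ eU) => /andP[-> ->] /andP[wqU _] /=.
  have /= -> := tV q w p (UVs _ _ wqU) qpV; move=> /(_ isT).
  by rewrite leqNgt ltn_sub2r.
- by apply/dp/(tV q p p (UVs _ _ pqU)).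
- by apply/dp/(tV p q q qpV)/UVs.
Qed.

Lemma regular_betweenE (U Z V : {set X * X}) :
  regular_between U V Z = [&& U \subset Z, Z \subset V & regular_between U Z Z].
Proof.
rewrite /regular_between subxx /=.
by case: (bipartitional Z); case: (U \subset Z); case: (Z \subset V); rewrite ?andbF.
Qed.

(** If [V] covers [U], the image of [U] under the involution lies strictly above [U] and below [V],
    hence is [V], with [rho] one larger. *)
Lemma rk_rho (U : Bip X) : rk U = rho (bip_rel U).
Proof.
suff /rk_unique E : is_rank_function (fun U : Bip X => rho (bip_rel U)) by rewrite -E.
split=> [{}U /forallP minU|{}U V /andP[UV /forallP cov]].
  have b0 : bipartitional (set0 : {set X * X}).
    by apply/andP; split; apply/transitive_setP => y x z; rewrite /= !inE.
  have := minU (MkBip b0); rewrite lt_neqAle leBipE sub0set andbT negbK => /eqP <- /=.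
  rewrite /rho; have -> : diag (set0 : {set X * X}) = set0 by apply/setP => x; rewrite !inE.
  rewrite imset0 !cards0 setC0 muln0 addn0 subn0.
  apply/eqP; rewrite subn_eq0; apply/card_le1_eqP => A C /imsetP[x _ ->] /imsetP[y _ ->].
  by apply/setP => z; rewrite !inE /sim !inE.
have [bU bV] := (valP U, valP V).
have pUV : bip_rel U \proper bip_rel V.
  by move: UV; rewrite lt_neqAle leBipE properEneq -(inj_eq val_inj).
have [f [fS fU]] := exists_sign_reversing bU bV pUV.
have [rfU _ _] := fS _ (regular_between_refl bU (proper_sub pUV)).
have /and4P[bf Uf fV _] := rfU.
have neq : bip_rel U != f U by apply/eqP => E; move: fU; rewrite -E => /n_Sn.
pose W := MkBip bf.
have UW : (U < W)%O by rewrite lt_neqAle leBipE Uf andbT -(inj_eq val_inj).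
have := cov W; rewrite UW /= lt_neqAle leBipE fV andbT negbK => /eqP <-.
exact: fU.
Qed.

Lemma sum_regular (U V : Bip X) : (U < V)%O ->
  (\sum_(Z : Bip X | regular_between U V Z) (-1) ^+ rho (bip_rel Z) = 0 :> int)%R.
Proof.
move=> UV.
have pUV : bip_rel U \proper bip_rel V.
  by move: UV; rewrite lt_neqAle leBipE properEneq -(inj_eq val_inj).
have [f [fS _]] := exists_sign_reversing (valP U) (valP V) pUV.
(* The default [Z] is never taken for regular [Z], where [f Z] is bipartitional. *)
pose g (Z : Bip X) : Bip X := insubd Z (f Z).
have gE (Z : Bip X) : regular_between U V Z -> bip_rel (g Z) = f Z.
  by move=> /fS[/and4P[bf _ _ _] _ _]; rewrite /g -[bip_rel _]/(val _) insubdK.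
have gK (Z : Bip X) : regular_between U V Z -> g (g Z) = Z.
  move=> rZ; apply: val_inj; have [rf ff _] := fS _ rZ.
  by rewrite /= gE ?gE.
set s := (\sum_(Z | _) _)%R.
have : s = (- s)%R.
  rewrite {1}/s (reindex_onto g g) //= /s -sumrN; apply: eq_big => Z.
    apply/andP/idP => [[rg /eqP gg]|rZ].
      by rewrite -gg gE //; case: (fS _ rg).
    by rewrite gE // gK // eqxx; case: (fS _ rZ).
  move=> /andP[rg /eqP gg].
  have rZ : regular_between U V Z by rewrite -gg gE //; case: (fS _ rg).
  rewrite gE //; case: (fS _ rZ) => _ _ o.
  by rewrite -signr_odd o signrN signr_odd.
by move/eqP; rewrite -addr_eq0 -mulr2n Num.Theory.mulrn_eq0 /= => /eqP.
Qed.

(** By [sum_regular] the right-hand side obeys the recursion [mobiusS]. The exponent is a sum, which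
    has the parity of the difference and factors easily. *)
Lemma mobius_bip (U V : Bip X) : (U <= V)%O ->
  mobius U V = (if regular_between U V V
               then (-1) ^+ (rho (bip_rel U) + rho (bip_rel V)) else 0)%R.
Proof.
have [n] := ubnP #|bip_rel V|; elim: n V => // n IHn V; rewrite ltnS => ltn.
rewrite le_eqVlt => /predU1P[<-|UV].
  rewrite mobiusxx regular_between_refl ?(valP U) //.
  by rewrite addnn -mul2n exprM sqrrN !expr1n.
have := mobiusS UV; rewrite (bigD1 V) /=; last by rewrite (ltW UV) lexx.
have {}IHn (Z : Bip X) : (U <= Z <= V)%O && (Z != V) -> mobius U Z =
    ((if regular_between U V Z then (-1) ^+ rho (bip_rel Z) else 0)
       * (-1) ^+ rho (bip_rel U))%R.
  case/andP=> /andP[UZ ZV] nZV.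
  rewrite IHn //; last first.
    apply: leq_trans ltn; apply: proper_card.
    by rewrite properEneq -(inj_eq val_inj) nZV.
  rewrite (regular_betweenE U Z V) -!leBipE UZ ZV /=.
  by case: ifP => _; rewrite ?mul0r // exprD mulrC.
rewrite (eq_bigr _ IHn) -mulr_suml -big_mkcondr /=.
have := sum_regular UV; rewrite (bigID (pred1 V)) /=.
have -> : (\sum_(Z : Bip X | regular_between U V Z && (Z == V)) (-1) ^+ rho (bip_rel Z) =
  if regular_between U V V then (-1) ^+ rho (bip_rel V) else 0 :> int)%R.
  by rewrite big_mkcondl /= big_pred1_eq.
have -> : (\sum_(Z : Bip X | regular_between U V Z && (Z != V)) (-1) ^+ rho (bip_rel Z) =
  \sum_(Z : Bip X | ((U <= Z <= V)%O && (Z != V)) && regular_between U V Z)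
    (-1) ^+ rho (bip_rel Z) :> int)%R.
  apply: eq_bigl => Z; rewrite regular_betweenE !leBipE.
  by case: (_ \subset _); case: (_ \subset _); rewrite ?andbF // andbC.
set t := (\sum_(Z | _) _)%R => /eqP; rewrite addrC addr_eq0 => /eqP -> /eqP.
rewrite mulNr subr_eq0 => /eqP ->.
by case: ifP => _; rewrite ?mul0r // exprD mulrC.
Qed.
End Main.

Theorem corollary10p3 (X : finType) (U V : Bip X)
    (le_UV : (U <= V)%O) (reg_UV : regular_interval U V) :
  mobius U V = ((-1) ^+ (rk V - rk U)%N)%R.
Proof.
rewrite mobius_bip // ifT; last first.
  apply/and4P; split; rewrite ?subxx //; first exact: (valP V).
  apply/forall_inP => x; rewrite !inE => xVU; apply/eqP/reg_UV.
  by rewrite inE.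
(* Sum and difference have equal parity because [rk_le] prevents truncation. *)
by rewrite -!rk_rho -signr_odd addnC oddD -oddB ?rk_le // signr_odd.
Qed.
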